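(* Let $n\ge2$ be the number of agents, let there be $k=1$ item, and consider the residual surplus objective. No platform mechanism is universally adopted with competitive advantage less than $4/3$: for every $\beta<4/3$ ($\beta>0$) and every platform mechanism $M$ there is a valuation profile $\mathbf v\in[0,\infty)^n$ with $M(\mathbf v)<\tfrac1\beta\,\mathcal G(\mathbf v)$.
   Context: One item, $n$ agents with values $\mathbf v\in[0,\infty)^n$. A platform mechanism $M$ is a single (prior-free, possibly randomized) direct mechanism with (measurable) allocation probabilities $x_i(\mathbf v)\in[0,1]$, $\sum_i x_i(\mathbf v)\le1$, and expected payments $p_i(\mathbf v)\ge0$, such that for every continuous distribution $F$ on $[0,\infty)$, when values are i.i.d. from $F$, truthtelling is a Bayes–Nash equilibrium and participation is interim individually rational. (With interim quantities $x_i(v_i)=\mathbf E_{\mathbf v_{-i}}[x_i(v_i,\mathbf v_{-i})]$ and $p_i(v_i)=\mathbf E_{\mathbf v_{-i}}[p_i(v_i,\mathbf v_{-i})]$, this means $x_i(\cdot)$ is non-decreasing and $p_i(v_i)=v_ix_i(v_i)-\int_0^{v_i}x_i(z)\,dz+p_i(0)$, with $p_i(0)=0$.) The expected residual surplus is $M(\mathbf v)=\sum_i(v_ix_i(\mathbf v)-p_i(\mathbf v))$. Two-level lottery. For $0\le q\le p\le\infty$, $\mathrm{Lot}_{p,q}$ serves a uniformly random agent with value strictly more than $p$ if one exists, otherwise a uniformly random agent with value strictly more than $q$ if one exists, otherwise nobody; payments are $p_i(\mathbf v)=v_ix_i(\mathbf v)-\int_0^{v_i}x_i(z,\mathbf v_{-i})\,dz$.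 $\mathrm{Lot}_{p,q}(\mathbf v)$ is its expected residual surplus. Benchmark. $\mathcal G(\mathbf v)=\sup_{0\le q\le p\le\infty}\mathrm{Lot}_{p,q}(\mathbf v)$; it equals the supremum, over continuous distributions $F$, of the residual surplus on $\mathbf v$ of the symmetric residual-surplus-optimal mechanism for values i.i.d. from $F$. *)

(* Defs.v *)
From HB Require Import structures.
From mathcomp Require Import all_boot all_order all_algebra.
From mathcomp Require Import all_classical all_reals all_analysis.

Set Implicit Arguments.
Unset Strict Implicit.
Unset Printing Implicit Defensive.
Import Order.TTheory GRing.Theory Num.Theory.
Import numFieldNormedType.Exports.

Local Open Scope classical_set_scope.
Local Open Scope ring_scope.

Section iid.
Context d (T : measurableType d) (R : realType).

Definition consm n (xt : T * n.-tuple T) : n.+1.-tuple T :=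
  [the n.+1.-tuple T of xt.1 :: xt.2].

Lemma measurable_consm n : measurable_fun setT (@consm n).
Proof. by apply: measurable_cons; [exact: measurable_fst|exact: measurable_snd]. Qed.

HB.instance Definition _ n :=
  @isMeasurableFun.Build _ _ _ _ (@consm n) (@measurable_consm n).

(** The law of [n] i.i.d. draws from [F], i.e. the [n]-fold product of [F] on
    the product sigma-algebra of [n.-tuple T] (see [iid_box]). *)
Fixpoint iid (F : probability T R) n : probability (n.-tuple T) R :=
  match n with
  | 0 => dirac [tuple]
  | m.+1 => distribution (F \x iid F m)%E (@consm m)
  end.

Local Open Scope ereal_scope.

Lemma iid_box (F : probability T R) n (A : 'I_n -> set T) :
  (forall i, measurable (A i)) ->
  iid F n [set w | forall i, A i (tnth w i)] = \prod_(i < n) F (A i).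
Proof.
elim: n A => [|n IH] A mA.
  rewrite big_ord0 /= diracE mem_set//= => -[]//.
rewrite big_ord_recl -IH//= /distribution /pushforward.
have -> : @consm n @^-1` [set w | forall i, A i (tnth w i)] =
    A ord0 `*` [set w | forall i, A (lift ord0 i) (tnth w i)].
  apply/seteqP; split => [[x t] /= h|[x t] /= [h0 h] i].
    split; first by have := h ord0; rewrite tnth0.
    by move=> i; have := h (lift ord0 i); rewrite /consm tnthS.
  by case: (unliftP ord0 i) => [j ->|->]; rewrite ?tnth0 // /consm tnthS.
rewrite product_measure1E//.
rewrite (_ : [set w | _] = \bigcap_(i in [set: 'I_n])
    ((@tnth n T)^~ i @^-1` A (lift ord0 i))); last first.
  by apply/seteqP; split => w /= h i; [move=> _|]; exact: h.
apply: fin_bigcap_measurable => // i _.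
by rewrite -[X in measurable X]setTI; exact: measurable_tnth.
Qed.

End iid.

Section platform.
Context (R : realType).

(** Only the values of [alloc] and [pay] on nonnegative profiles are ever
    used, so the ambient type of profiles is [n.-tuple R]. *)
Record mechanism (n : nat) := Mechanism {
  alloc : 'I_n -> n.-tuple R -> R ;
  pay   : 'I_n -> n.-tuple R -> R }.

Definition nneg_profile n : set (n.-tuple R) :=
  [set v | forall i, 0 <= tnth v i].

Definition residual_surplus n (M : mechanism n) (v : n.-tuple R) : R :=
  \sum_(i < n) (tnth v i * alloc M i v - pay M i v).

Definition subst_coord n (v : n.-tuple R) (i : 'I_n) (z : R) : n.-tuple R :=
  [tuple if j == i then z else tnth v j | j < n].

Definition continuous_distribution (F : probability R R) : Prop :=
  F `[0, +oo[%classic = 1%E /\ continuous (fun r : R => fine (F `]-oo, r]%classic)).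

Section interim.
Local Open Scope ereal_scope.
Context n (M : mechanism n) (F : probability R R) (i : 'I_n).

(** Coordinate [i] of the i.i.d. profile [w] is overwritten by the report [b],
    so these are expectations over the values of the agents other than [i]. *)
Definition interim_alloc (b : R) : \bar R :=
  \int[iid F n]_(w in @nneg_profile n) (alloc M i (subst_coord w i b))%:E.

Definition interim_pay (b : R) : \bar R :=
  \int[iid F n]_(w in @nneg_profile n) (pay M i (subst_coord w i b))%:E.

(** Expected utility of agent [i] with value [v] reporting [b]. The interim
    allocation lies in [0, 1]; only the payment may be infinite. *)
Definition interim_utility (v b : R) : \bar R :=
  v%:E * interim_alloc b - interim_pay b.

End interim.

Definition truthful_BNE n (M : mechanism n) (F : probability R R) : Prop :=
  forall (i : 'I_n) (v b : R), 0 <= v -> 0 <= b ->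
    (interim_utility M F i v b <= interim_utility M F i v v)%E.

Definition interim_IR n (M : mechanism n) (F : probability R R) : Prop :=
  forall (i : 'I_n) (v : R), 0 <= v -> (0 <= interim_utility M F i v v)%E.

Record platform_mechanism n (M : mechanism n) : Prop := {
  alloc_measurable : forall i, measurable_fun (@nneg_profile n) (alloc M i) ;
  pay_measurable : forall i, measurable_fun (@nneg_profile n) (pay M i) ;
  alloc_itv : forall i v, nneg_profile v -> 0 <= alloc M i v <= 1 ;
  alloc_sum : forall v, nneg_profile v -> \sum_(i < n) alloc M i v <= 1 ;
  pay_ge0 : forall i v, nneg_profile v -> 0 <= pay M i v ;
  platform_BNE : forall F, continuous_distribution F -> truthful_BNE M F ;
  platform_IR : forall F, continuous_distribution F -> interim_IR M F }.

Definition above n (t : \bar R) (v : n.-tuple R) : pred 'I_n :=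
  [pred j | (t < (tnth v j)%:E)%E].

Definition lottery_alloc n (p q : \bar R) (i : 'I_n) (v : n.-tuple R) : R :=
  let winners := if [exists j, above p v j] then above p v else above q v in
  if i \in winners then #|winners|%:R^-1 else 0.

Definition lottery_pay n (p q : \bar R) (i : 'I_n) (v : n.-tuple R) : R :=
  tnth v i * lottery_alloc p q i v
  - \int[lebesgue_measure]_(z in `[0, tnth v i]%classic)
      lottery_alloc p q i (subst_coord v i z).

Definition lottery n (p q : \bar R) : mechanism n :=
  Mechanism (@lottery_alloc n p q) (@lottery_pay n p q).

Definition benchmark n (v : n.-tuple R) : \bar R :=
  ereal_sup [set (residual_surplus (lottery n pq.1 pq.2) v)%:E
            | pq in [set pq : \bar R * \bar R | (0 <= pq.2 <= pq.1)%E]].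

End platform.

(* Main.v *)
(** Let the values be i.i.d. standard exponential. Its density is its own tail
    (virtual surplus is constantly 1), so by the envelope formula an agent's
    expected utility is at most its expected allocation, and every platform
    mechanism has expected residual surplus at most 1.

    For the benchmark, let [v1 >= v2] be the two highest values and [m] the
    third one ([0] when n = 2). The lotteries [Lot_{m,m}] and [Lot_{v2,m}] earn at
    least [(v1 + v2) / 2 - m] and [v1 - v2 / 2 - m / 2]. By memorylessness,
    [v1 - m] and [v2 - m] are, up to order, two independent exponentials
    [a], [b], and the maximum of the two amounts has mean
    E[(a + b) / 2] + E[(a - 2 b)^+ + (b - 2 a)^+] / 2 = 1 + 1/3.
    So a mechanism with G <= beta M pointwise has beta >= 4/3. Instead of
    sorting, the expectation is summed over the ordered pairs of agents that may
    occupy the top two places. *)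
From HB Require Import structures.
Require Import Defs.
From mathcomp Require Import all_boot all_order all_algebra.
From mathcomp Require Import all_classical all_reals all_analysis.
From mathcomp Require Import measurable_realfun.
From mathcomp Require Import lra ring.

Set Implicit Arguments.
Unset Strict Implicit.
Unset Printing Implicit Defensive.
Import Order.TTheory GRing.Theory Num.Theory.
Import numFieldNormedType.Exports.

Local Open Scope classical_set_scope.
Local Open Scope ring_scope.

(** * Integration against a measure given by a density *)

Section density.
Local Open Scope ereal_scope.
Context d (T : measurableType d) (R : realType).
Context (mu nu : {measure set T -> \bar R}) (g : T -> R).
Hypotheses (mg : measurable_fun setT g) (g0 : forall x, (0 <= g x)%R).
Hypothesis nuE : forall A, measurable A -> nu A = \int[mu]_(x in A) (g x)%:E.

Import HBNNSimple.

Let integral_density_nnsfun (h : {nnsfun T >-> R}) :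
  \int[nu]_x (h x)%:E = \int[mu]_x ((h x)%:E * (g x)%:E).
Proof.
have mind (r : R) : measurable_fun setT (\1_(h @^-1` [set r]) : T -> R).
  exact: measurable_indic.
under eq_integral do rewrite fimfunE -fsumEFin//.
rewrite ge0_integral_fsum//; last 2 first.
- by move=> r; exact/measurable_EFinP/measurable_funM.
- by move=> r x _; rewrite nnfun_muleindic_ge0.
transitivity (\sum_(r \in range h)
    \int[mu]_x ((r * \1_(h @^-1` [set r]) x)%:E * (g x)%:E)); last first.
  rewrite -ge0_integral_fsum//.
  - apply: eq_integral => x _.
    rewrite [in RHS]fimfunE -fsumEFin// ge0_mule_fsuml// => r.
    exact: nnfun_muleindic_ge0.
  - move=> r; apply: emeasurable_funM; last exact/measurable_EFinP.
    exact/measurable_EFinP/measurable_funM.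
  - by move=> r x _; rewrite mule_ge0 ?lee_fin ?g0// -lee_fin nnfun_muleindic_ge0.
apply: eq_fsbigr => r _; rewrite integralZl_indic_nnsfun// integral_indic// setIT.
have [r0|r0] := ltP r 0%R.
  rewrite preimage_nnfun0// measure0 mule0 integral0_eq// => x _.
  by rewrite indicE in_set0 mulr0 mul0e.
under eq_integral do rewrite EFinM -muleA.
rewrite ge0_integralZl//.
- rewrite nuE// integral_mkcond; congr (_ * _); apply: eq_integral => x _.
  by rewrite patchE indicE; case: ifPn => _; rewrite ?mul1e ?mul0e.
- by apply: emeasurable_funM; exact/measurable_EFinP.
- by move=> x _; rewrite mule_ge0 ?lee_fin.
Qed.

(** For simple functions this is linearity together with [nuE] on level sets; monotone convergence
    along [nnsfun_approx] extends it to [f]. *)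
Lemma ge0_integral_density (f : T -> \bar R) :
  measurable_fun setT f -> (forall x, 0 <= f x) ->
  \int[nu]_x f x = \int[mu]_x (f x * (g x)%:E).
Proof.
move=> mf f0; pose f_ := nnsfun_approx measurableT mf.
have f_cvg x : EFin \o f_ ^~ x @ \oo --> f x by exact: cvg_nnsfun_approx.
have f_nd x : {homo (f_ ^~ x) : m n / (m <= n)%N >-> (m <= n)%R}.
  by move=> m n mn; exact/lefP/nd_nnsfun_approx.
transitivity (limn (fun n => \int[nu]_x (f_ n x)%:E)).
  rewrite -monotone_convergence//.
  - by apply: eq_integral => x _; apply/esym/cvg_lim => //; exact: f_cvg.
  - by move=> n; exact/measurable_EFinP.
  - by move=> n x _; rewrite lee_fin.
  - by move=> x _ m n mn; rewrite lee_fin f_nd.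
under eq_fun do rewrite integral_density_nnsfun.
rewrite -monotone_convergence//.
- apply: eq_integral => x _; apply/cvg_lim => //.
  by apply: cvgeMr => //; exact: f_cvg.
- by move=> n; apply: emeasurable_funM; exact/measurable_EFinP.
- by move=> n x _; rewrite mule_ge0 ?lee_fin.
- by move=> x _ m n mn; rewrite lee_wpmul2r ?lee_fin ?f_nd.
Qed.

End density.

(** * The standard exponential law *)

Section exponential.
Context (R : realType).
Local Notation mu := (@lebesgue_measure R).

Lemma integral_exponential_pdf_tail (rate c : R) : 0 < rate -> 0 <= c ->
  (\int[mu]_(x in `[c, +oo[) (exponential_pdf rate x)%:E =
   (expR (- rate * c))%:E)%E.
Proof.
move=> rate0 c0.
have dE x : derivable (fun x => - expR (- rate * x)) x 1 by exact: ex_derive.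
rewrite (@ge0_continuous_FTC2y _ _ (fun x => - expR (- rate * x)) _ 0)//.
- by rewrite -EFinB sub0r opprK.
- by move=> x _; apply: exponential_pdf_ge0; exact: ltW.
- apply: (@continuous_subspaceW R^o _ _ [set` `[0, +oo[%R]).
    by move=> x /=; rewrite !in_itv/= !andbT; exact: le_trans.
  exact: within_continuous_exponential_pdf.
- rewrite -oppr0; apply: cvgN.
  rewrite (_ : (fun x => expR (- rate * x)) =
               (fun z => expR (- z)) \o (fun z => rate * z)); last first.
    by apply: eq_fun => x; rewrite mulNr.
  apply: (@cvg_comp _ _ _ _ _ _ (pinfty_nbhs R)); last exact: cvgr_expR.
  exact: gt0_cvgMry.
- apply/cvg_at_right_filter.
  exact: (differentiable_continuous ((derivable1_diffP _ _).1 (dE c))).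
- move=> x; rewrite in_itv/= andbT => cx; apply: derive1_exponential_pdf.
  by rewrite in_itv/= andbT (le_lt_trans c0).
Qed.

Let exponential_prob1 : probability (measurableTypeR R) R :=
  exponential_distribution.exponential_distribution_exponential_prob__canonical__probability_measure_Probability
    (@ltr01 R).

(** The exponential law is given on [measurableTypeR R], whereas [continuous_distribution] expects a
    [probability R R]; pushing forward along the identity passes from one measurable structure to
    the other. *)
Let idTR : measurableTypeR R -> R := idfun.

Let measurable_idTR : measurable_fun setT idTR.
Proof. by move=> _ A mA; rewrite setTI. Qed.

HB.instance Definition _ :=
  @isMeasurableFun.Build _ _ _ _ idTR measurable_idTR.

Definition exp1 : probability R R := distribution exponential_prob1 idTR.

Lemma exp1E A : exp1 A = (\int[mu]_(x in A) (exponential_pdf 1 x)%:E)%E.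
Proof. by []. Qed.

Lemma exp1_tail (c : R) : 0 <= c -> exp1 `[c, +oo[%classic = (expR (- c))%:E.
Proof. by move=> c0; rewrite exp1E integral_exponential_pdf_tail// mulN1r. Qed.

Lemma exp1_otail (c : R) : 0 <= c -> exp1 `]c, +oo[%classic = (expR (- c))%:E.
Proof.
move=> c0; rewrite exp1E integral_itv_obnd_cbnd -?exp1E ?exp1_tail//.
by apply/measurable_EFinP/measurable_funTS; exact: measurable_exponential_pdf.
Qed.

(** This gives access to the equilibrium and rationality conditions of a platform mechanism at the
    exponential law. *)
Lemma exp1_continuous_distribution : continuous_distribution exp1.
Proof.
split; first by rewrite exp1_tail// oppr0 expR0.
(* Truncating at 0 covers negative [r] as well, so the distribution function becomes one composition
   of continuous maps. *)
rewrite (_ : (fun _ => _) = fun r => 1 - expR (- Num.max r 0)); last first.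
  apply/funext => r; rewrite -setCitvr probability_setC//.
  rewrite (_ : exp1 `]r, +oo[%classic = (expR (- Num.max r 0))%:E) ?fineB//.
  have [r0|r0] := leP 0 r; first by rewrite exp1_otail.
  apply/eqP; rewrite eq_le oppr0 expR0 probability_le1//=.
  rewrite -[X in (X%:E <= _)%E]expR0 -oppr0 -exp1_tail//.
  apply: le_measure; rewrite ?inE// => x /=.
  by rewrite !in_itv/= !andbT; exact: lt_le_trans.
move=> r; apply: cvgB; first exact: cvg_cst.
apply: continuous_comp; last exact: continuous_expR.
apply: cvgN; apply: (@continuous_max _ _ id (cst 0)) => //; exact: cvg_cst.
Qed.

Lemma ge0_integral_exp1 (f : R -> \bar R) :
  measurable_fun setT f -> (forall x, 0 <= f x)%E ->
  (\int[exp1]_x f x = \int[mu]_x (f x * (exponential_pdf 1 x)%:E))%E.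
Proof.
move=> mf f0.
rewrite ge0_integral_distribution// (ge0_integral_density (mu := mu) (g := exponential_pdf 1))//.
- exact: measurable_exponential_pdf.
- by move=> x; exact: exponential_pdf_ge0.
Qed.

End exponential.

(** * Exponential integrals and the expected surplus of a pair *)

Section exponential_calculus.
Context (R : realType).
Local Notation mu := (@lebesgue_measure R).
Local Notation F := (exp1 R).

Section primitive.
Variable f : R -> \bar R.
Hypotheses (mf : measurable_fun setT f) (f0 : forall x, (0 <= f x)%E).

(** The integral over an interval with moving endpoint becomes a section of a function on the plane,
    so Tonelli yields both measurability in [v] and the exchange of integrals. *)
Let g (vz : R * measurableTypeR R) : \bar R :=
  if (0 <= (vz.2 : R)) && ((vz.2 : R) <= vz.1) then f vz.2 else 0.

Let mg : measurable_fun setT g.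
Proof.
have m2 : measurable_fun setT (fun vz : R * measurableTypeR R => vz.2 : R).
  exact: measurable_snd.
apply: measurable_fun_ifT => //; last exact: (measurableT_comp mf m2).
by apply: measurable_and; apply: measurable_fun_ler.
Qed.

Let g0 vz : (0 <= g vz)%E.
Proof. by rewrite /g; case: ifPn. Qed.

Let gE v : (\int[mu]_(z in `[0%R, v]) f z = \int[mu]_z g (v, z))%E.
Proof.
rewrite integral_mkcond; apply: eq_integral => z _.
rewrite patchE /g/=; case: ifPn; rewrite ?notin_setE ?inE/= in_itv/=.
  by move=> ->.
by move/negP/negbTE => ->.
Qed.

Lemma measurable_primitive :
  measurable_fun setT (fun v : R => \int[mu]_(z in `[0%R, v]) f z)%E.
Proof.
under eq_fun do rewrite gE.
exact: (measurable_fun_fubini_tonelli_F (m2 := mu) g).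
Qed.

(* The density of [exp1] is its own tail, so exchanging the order of
   integration gives back the law. *)
Lemma integral_exp1_primitive :
  (\int[F]_v \int[mu]_(z in `[0%R, v]) f z = \int[F]_z f z)%E.
Proof.
under eq_integral do rewrite gE.
rewrite (fubini_tonelli (m1 := F) (m2 := mu) g)// ge0_integral_exp1//.
apply: eq_integral => z _; have [z0|z0] := leP 0 z; last first.
  rewrite lt0_exponential_pdf// mule0 integral0_eq// => v _.
  by rewrite /g/= leNgt z0.
rewrite exponential_pdfE// mul1r mulN1r -exp1_tail// -[X in F X]setIT.
rewrite -integral_indic// -ge0_integralZl//=; last first.
  by apply/measurable_EFinP; exact: measurable_indic.
apply: eq_integral => v _; rewrite /g/= z0/= indicE.
have [zv|zv] := leP z v; first by rewrite mem_set ?mule1//= in_itv/= zv.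
by rewrite memNset ?mule0//= in_itv/= leNgt zv.
Qed.

End primitive.

Lemma lebesgue_measure_excess (t v : R) : 0 <= t ->
  mu (`]t, +oo[ `&` `[0, v]) = (Num.max (v - t) 0)%:E.
Proof.
move=> t0; rewrite (_ : _ `&` _ = `]t, v]%classic).
  rewrite [LHS](lebesgue_measure_itv `]t, v])/= lte_fin.
  have [tv|tv] := ltP t v; first by rewrite max_l// subr_ge0 ltW.
  by rewrite max_r// subr_le0.
apply/seteqP; split => x /=; rewrite !in_itv/= ?andbT.
  by case=> -> /andP[].
by move=> /andP[tx xv]; rewrite tx xv (le_trans t0 (ltW tx)).
Qed.

(** The positive part of [v - t] is the primitive of the indicator of []t, +oo[], so
    [integral_exp1_primitive] turns its mean into a tail probability. *)
Lemma integral_exp1_excess (t : R) : 0 <= t ->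
  (\int[F]_v (Num.max (v - t) 0)%:E = (expR (- t))%:E)%E.
Proof.
move=> t0; rewrite -exp1_otail// -[X in F X]setIT -integral_indic//.
rewrite -[RHS]integral_exp1_primitive; last 2 first.
- by apply/measurable_EFinP; exact: measurable_indic.
- by move=> x; rewrite lee_fin.
apply: eq_integral => v _.
by rewrite integral_indic//; exact/esym/lebesgue_measure_excess.
Qed.

(** Against the density, the integrand becomes [expR c / 3] times the exponential density of rate 3,
    whose tail at [c] is [expR (- 3 * c)]. This is the mean over [b] of the excess of [a] over
    [2 * b - c], and the source of the extra 1/3. *)
Lemma integral_exp1_expR (c : R) : 0 <= c ->
  (\int[F]_v (if (c < v)%R then expR (- (2 * v - c)) else 0)%:E =
   (expR (- (2 * c)) / 3)%:E)%E.
Proof.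
move=> c0; rewrite ge0_integral_exp1; last 2 first.
- apply/measurable_EFinP/measurable_fun_ifT => //.
    exact: measurable_fun_ltr.
  apply: measurableT_comp => //; apply: measurableT_comp => //.
  by apply: measurable_funB => //; exact: measurable_funM.
- by move=> v; rewrite lee_fin; case: ifP => // _; exact: expR_ge0.
transitivity ((expR c / 3)%:E * \int[mu]_(z in `]c, +oo[) (exponential_pdf 3 z)%:E)%E.
  rewrite -ge0_integralZl//; last 2 first.
  - apply/measurable_EFinP/measurable_funTS.
    exact: measurable_exponential_pdf.
  - by move=> z _; rewrite lee_fin; exact: exponential_pdf_ge0.
  rewrite [RHS]integral_mkcond.
  apply: eq_integral => z _; rewrite patchE.
  have [cz|cz] := ltP c z; last first.
    by rewrite memNset ?mul0e//= in_itv/= andbT ltNge cz.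
  rewrite mem_set/= ?in_itv/= ?andbT// -!EFinM !exponential_pdfE; last 2 first.
  - exact: le_trans c0 (ltW cz).
  - exact: le_trans c0 (ltW cz).
  rewrite mul1r mulN1r -expRD mulrA divfK// -expRD; congr (expR _)%:E.
  by ring.
rewrite integral_itv_obnd_cbnd; last first.
  by apply/measurable_EFinP/measurable_funTS; exact: measurable_exponential_pdf.
rewrite integral_exponential_pdf_tail// -EFinM mulrAC -expRD.
by congr (expR _ / _)%:E; ring.
Qed.

(** As a function of its own report, an agent's allocation in a two-level lottery jumps at most
    twice; this computes the area under such a curve. *)
Lemma Rintegral_steps (t s v a b : R) : 0 <= t -> 0 <= s -> 0 <= a -> 0 <= b ->
  \int[mu]_(z in `[0, v]) (a * \1_`]t, +oo[ z + b * \1_`]s, +oo[ z) =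
  a * Num.max (v - t) 0 + b * Num.max (v - s) 0.
Proof.
move=> t0 s0 a0 b0.
have mstep (c r : R) : measurable_fun `[0, v]%classic
    (fun z : R => (c * \1_`]r, +oo[%classic z)%:E).
  by apply/measurable_EFinP; exact: measurable_funM.
have step (c r : R) : 0 <= c -> 0 <= r ->
    (\int[mu]_(z in `[0%R, v]) (c * \1_`]r, +oo[ z)%:E =
     (c * Num.max (v - r) 0)%:E)%E.
  move=> c0 r0; under eq_integral do rewrite EFinM.
  rewrite ge0_integralZl//; last by apply/measurable_EFinP; exact: measurable_indic.
  rewrite integral_indic// EFinM; congr (_ * _)%E.
  exact: lebesgue_measure_excess.
rewrite /Rintegral; under eq_integral do rewrite EFinD.
rewrite ge0_integralD//; last 4 first.
- by move=> z _; rewrite lee_fin mulr_ge0.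
- exact: mstep.
- by move=> z _; rewrite lee_fin mulr_ge0.
- exact: mstep.
by rewrite !step.
Qed.

(* With [a], [b] the values of two agents and [c] the highest other value, the
   sum of this expression and of its mirror image in [a], [b] is twice the better
   of the surpluses of [Lot_{c,c}] and [Lot_{min a b, c}], and it vanishes unless
   [a] and [b] both exceed [c]. *)
Definition top_pair_surplus (c a b : R) : R :=
  if c < b then Num.max (a - c) 0 + Num.max (a - (2 * b - c)) 0 else 0.

Lemma top_pair_surplus_ge0 c a b : 0 <= top_pair_surplus c a b.
Proof.
by rewrite /top_pair_surplus; case: ifP => // _; rewrite addr_ge0// le_max lexx orbT.
Qed.

Lemma measurable_top_pair_surplus d (T : measurableType d) (c a b : T -> R) :
  measurable_fun setT c -> measurable_fun setT a -> measurable_fun setT b ->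
  measurable_fun setT (fun x => top_pair_surplus (c x) (a x) (b x)).
Proof.
move=> mc ma mb; apply: measurable_fun_ifT => //; first exact: measurable_fun_ltr.
apply: measurable_funD; apply: measurable_maxr => //; apply: measurable_funB => //.
by apply: measurable_funB => //; exact: measurable_funM.
Qed.

(** For [b] above [c], the mean over [a] is [expR (- c) + expR (- (2 * b - c))]. Averaging over [b]
    gives [expR (- (2 * c))] times 1 + 1/3, and [expR (- (2 * c))] is the probability that both
    values reach [c]. *)
Lemma integral_top_pair_surplus (c : R) : 0 <= c ->
  (\int[F]_b \int[F]_a (top_pair_surplus c a b)%:E =
   (4 / 3)%:E * F `[c, +oo[%classic * F `[c, +oo[%classic)%E.
Proof.
move=> c0.
have mexcess t : measurable_fun setT (fun a : R => (Num.max (a - t) 0)%:E).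
  apply/measurable_EFinP; apply: measurable_maxr => //.
  exact: measurable_funB.
transitivity (\int[F]_b ((expR (- c))%:E * (\1_`]c, +oo[%classic b)%:E
    + (if (c < b)%R then expR (- (2 * b - c)) else 0)%:E))%E.
  apply: eq_integral => b _; rewrite /top_pair_surplus indicE.
  have [cb|cb] := ltP c b; last first.
    by rewrite integral0_eq// memNset ?mule0 ?adde0//= in_itv/= andbT ltNge cb.
  under eq_integral do rewrite EFinD.
  rewrite ge0_integralD//; last 2 first.
  - by move=> a _; rewrite lee_fin le_max lexx orbT.
  - by move=> a _; rewrite lee_fin le_max lexx orbT.
  rewrite !integral_exp1_excess//; last first.
    by rewrite subr_ge0 (le_trans (ltW cb))// ler_peMl ?ler1n// (le_trans c0 (ltW cb)).
  by rewrite mem_set ?mule1//= in_itv/= cb.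
rewrite ge0_integralD//; last 3 first.
- apply: emeasurable_funM => //; apply/measurable_EFinP.
  exact: measurable_indic.
- by move=> b _; rewrite lee_fin; case: ifP => // _; exact: expR_ge0.
- apply/measurable_EFinP/measurable_fun_ifT => //.
    exact: measurable_fun_ltr.
  apply: measurableT_comp => //; apply: measurableT_comp => //.
  by apply: measurable_funB => //; exact: measurable_funM.
rewrite integral_exp1_expR// ge0_integralZl//; last first.
  by apply/measurable_EFinP; exact: measurable_indic.
rewrite integral_indic// setIT [LHS]/= exp1_otail// exp1_tail//.
rewrite -!EFinM -EFinD; congr EFin.
by rewrite (_ : - (2 * c) = - c + - c) ?expRD; [field|ring].
Qed.

End exponential_calculus.

(** * Envelope bound for one truthful agent *)

Section single_agent.
Context (R : realType).
Local Notation mu := (@lebesgue_measure R).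
Local Notation F := (exp1 R).
Variables (x p : R -> R).
Hypotheses (mx : measurable_fun setT x) (mp : measurable_fun setT p).
Hypotheses (x_ge0 : forall v, 0 <= x v) (p_ge0 : forall v, 0 <= p v).
Hypothesis x_lt0 : forall v, v < 0 -> x v = 0.
Hypothesis truthful : forall v b, 0 <= v -> 0 <= b ->
  v * x b - p b <= v * x v - p v.

Let u v := v * x v - p v.
Let I v := (\int[mu]_(z in `[0%R, v]) (x z)%:E)%E.

Let u_incr a b : 0 <= a -> a <= b -> u b <= u a + (b - a) * x b.
Proof.
move=> a0 ab; have := truthful a0 (le_trans a0 ab).
by rewrite /u; lra.
Qed.

(** Adding the constraints that neither of the types [a] and [b] gains by mimicking the other gives
    [0 <= (b - a) * (x b - x a)]. *)
Let x_nd a b : 0 <= a -> a <= b -> x a <= x b.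
Proof.
move=> a0; rewrite le_eqVlt => /predU1P[->//|ab].
have b0 : 0 <= b by rewrite (le_trans a0)// ltW.
have h1 := truthful a0 b0; have h2 := truthful b0 a0.
have : 0 <= (b - a) * (x b - x a) by lra.
by rewrite pmulr_rge0 ?subr_gt0// subr_ge0.
Qed.

(* Truthfulness bounds each increment of [u] by [h] times [x] at the right end of
   the step, whereas the integral dominates [h] times [x] at the left end; the
   last term is the telescoped difference. *)
Let utility_grid (h : R) (k : nat) : 0 <= h ->
  ((u (k%:R * h))%:E <= I (k%:R * h)%R + (h * x (k%:R * h))%:E)%E.
Proof.
move=> h0; elim: k => [|k IH].
  (* At value 0 the utility is [- p 0], which is nonpositive because payments are nonnegative. *)
  rewrite mul0r /u mul0r add0r (@le_trans _ _ 0%E)//.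
    by rewrite lee_fin oppr_le0.
  rewrite adde_ge0 ?lee_fin ?mulr_ge0//.
  by apply: integral_ge0 => z _; rewrite lee_fin.
set a := k%:R * h in IH *; set b := k.+1%:R * h.
have a0 : 0 <= a by rewrite mulr_ge0.
have ba : b - a = h by rewrite -mulrBl -natrB// subSnn mul1r.
have ab : a <= b by rewrite -subr_ge0 ba.
have IbE : (I a + (h * x a)%:E <= I b)%E.
  rewrite /I (@itv_bndbnd_setU _ _ (BLeft 0) (BRight a) (BRight b)) ?bnd_simp//.
  rewrite ge0_integral_setU//=; last 3 first.
  - by apply/measurable_EFinP/measurable_funTS.
  - by move=> z _; rewrite lee_fin.
  - apply/disj_setPS => z /= []; rewrite !in_itv/= => /andP[_ za] /andP[az _].
    by move: (lt_le_trans az za); rewrite ltxx.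
  apply: leeD => //.
  have -> : ((h * x a)%:E = \int[mu]_(z in `]a, b]) (cst (x a)%:E) z)%E.
    rewrite integral_cst// [X in (_ * X)%E](lebesgue_measure_itv `]a, b])/=.
    rewrite lte_fin; have [ab'|ba'] := ltP a b; first by rewrite -EFinD -EFinM ba mulrC.
    by rewrite mule0 -ba (@le_anti _ _ a b) ?subrr ?mul0r// ab.
  apply: ge0_le_integral => //.
  - by move=> z _; rewrite lee_fin.
  - by apply/measurable_EFinP/measurable_funTS.
  - move=> z /=; rewrite in_itv/= => /andP[az _].
    by rewrite lee_fin x_nd// ltW.
apply: (@le_trans _ _ ((u a + h * x b)%:E)).
  by rewrite lee_fin -ba u_incr.
by rewrite EFinD leeD// (le_trans IH).
Qed.

Let utility_le v : 0 <= v -> ((u v)%:E <= I v)%E.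
Proof.
move=> v0; apply/lee_addgt0Pr => e e0.
(* With [n.+1] steps the mesh is [v / n.+1%:R], and this [n] makes the grid error
   [v / n.+1%:R * x v] at most [e]. *)
pose n := Num.truncn (v * x v / e).
have n1 : 0 < n.+1%:R :> R by rewrite ltr0n.
have := @utility_grid (v / n.+1%:R) n.+1 (divr_ge0 v0 (ltW n1)).
rewrite mulrC divfK ?gt_eqF// => /le_trans; apply.
apply: leeD => //; rewrite lee_fin mulrAC ler_pdivrMr// [leRHS]mulrC -ler_pdivrMr//.
exact/ltW/truncnS_gt.
Qed.

(** For nonnegative [v], [v * x v] is [u v + p v], and [u v] is at most the integral of [x] over
    [[0, v]], whose mean under [F] is the mean of [x]. Payments stay on the right so that only
    nonnegative functions are integrated. *)
Lemma exp1_envelope :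
  (\int[F]_v (v * x v)%:E <= \int[F]_v (p v)%:E + \int[F]_v (x v)%:E)%E.
Proof.
have mEx : measurable_fun setT (EFin \o x) by exact/measurable_EFinP.
have xE0 (v : R) : (0 <= (x v)%:E)%E by rewrite lee_fin.
rewrite -(integral_exp1_primitive mEx xE0) -ge0_integralD//; last 4 first.
- by move=> v _; rewrite lee_fin.
- exact/measurable_EFinP.
- by move=> v _; apply: integral_ge0 => z _; exact: xE0.
- exact: measurable_primitive.
apply: ge0_le_integral => //.
- move=> v _; rewrite lee_fin; have [v0|v0] := leP 0 v; first exact: mulr_ge0.
  by rewrite x_lt0 ?mulr0.
- by apply/measurable_EFinP; exact: measurable_funM.
- apply: emeasurable_funD; first exact/measurable_EFinP.
  exact: measurable_primitive.
- move=> v _; have [v0|v0] := leP 0 v.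
    have := utility_le v0; rewrite /u EFinB.
    by rewrite leeBlDl.
  by rewrite x_lt0// mulr0 adde_ge0 ?lee_fin//; apply: integral_ge0 => z _; exact: xE0.
Qed.

End single_agent.

(** * Resampling one coordinate of an i.i.d. profile *)

Section resampling.
Context (R : realType) (F : probability R R).

Lemma tnth_subst_coord n (w : n.-tuple R) (i j : 'I_n) z :
  tnth (subst_coord w i z) j = if j == i then z else tnth w j.
Proof. by rewrite tnth_mktuple. Qed.

Lemma measurable_subst_coord d (T : measurableType d) n (i : 'I_n)
    (w : T -> n.-tuple R) (z : T -> R) :
  measurable_fun setT w -> measurable_fun setT z ->
  measurable_fun setT (fun x => subst_coord (w x) i (z x)).
Proof.
move=> mw mz; apply/measurable_fun_tnthP => j.
rewrite (_ : _ \o _ = fun x => if j == i then z x else tnth (w x) j); last first.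
  by apply/funext => x /=; rewrite tnth_subst_coord.
case: (j == i) => //.
exact: (measurableT_comp (measurable_tnth j) mw).
Qed.

Lemma ge0_integral_iidS n (f : n.+1.-tuple R -> \bar R) :
  measurable_fun setT f -> (forall w, 0 <= f w)%E ->
  (\int[iid F n.+1]_w f w =
   \int[F]_x \int[iid F n]_w f [the n.+1.-tuple R of x :: w])%E.
Proof.
move=> mf f0; rewrite ge0_integral_distribution//.
rewrite (fubini_tonelli1 (m1 := F) (m2 := iid F n) (f \o @consm _ _ n))//.
  exact: (measurableT_comp mf).
by move=> xw; exact: f0.
Qed.

Lemma measurable_integral_subst n (i : 'I_n) (f : n.-tuple R -> \bar R) :
  measurable_fun setT f -> (forall w, 0 <= f w)%E ->
  measurable_fun setT (fun v => \int[iid F n]_w f (subst_coord w i v))%E.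
Proof.
move=> mf f0.
apply: (measurable_fun_fubini_tonelli_F (m2 := iid F n)
  (fun vw : R * n.-tuple R => f (subst_coord vw.2 i vw.1))) => //.
apply: measurableT_comp => //.
by apply: measurable_subst_coord.
Qed.

Lemma integral_subst_swap n (i : 'I_n) (f : n.-tuple R -> \bar R) :
  measurable_fun setT f -> (forall w, 0 <= f w)%E ->
  (\int[F]_v \int[iid F n]_w f (subst_coord w i v) =
   \int[iid F n]_w \int[F]_v f (subst_coord w i v))%E.
Proof.
move=> mf f0.
rewrite (fubini_tonelli (m1 := F) (m2 := iid F n)
  (fun vw : R * n.-tuple R => f (subst_coord vw.2 i vw.1)))//.
apply: measurableT_comp => //.
by apply: measurable_subst_coord.
Qed.

(** Interim quantities overwrite coordinate [i] by a report, so this expresses ex ante expectations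
    as means of interim ones. The proof peels off the head coordinate by induction. *)
Lemma integral_iid_resample n (i : 'I_n) (f : n.-tuple R -> \bar R) :
  measurable_fun setT f -> (forall w, 0 <= f w)%E ->
  (\int[iid F n]_w f w = \int[F]_v \int[iid F n]_w f (subst_coord w i v))%E.
Proof.
elim: n i f => [[]//|n IH] i f mf f0.
have mcons x : measurable_fun setT (fun w : n.-tuple R => f [the n.+1.-tuple R of x :: w]).
  apply: measurableT_comp => //.
  by apply: measurable_cons => //.
have msubst v : measurable_fun setT (fun w : n.+1.-tuple R => f (subst_coord w i v)).
  by apply: measurableT_comp => //; apply: measurable_subst_coord.
under [RHS]eq_integral do rewrite ge0_integral_iidS//.
rewrite ge0_integral_iidS//.
case: (unliftP ord0 i) msubst => [j|] -> msubst.
(* The resampled coordinate lies in the tail: the induction hypothesis applies for each fixed head,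
   and Tonelli exchanges the head with the fresh draw. *)
- have consE v x (w : n.-tuple R) :
      subst_coord [the n.+1.-tuple R of x :: w] (lift ord0 j) v =
      [the n.+1.-tuple R of x :: subst_coord w j v].
    apply: eq_from_tnth => k; rewrite tnth_subst_coord.
    case: (unliftP ord0 k) => [l ->|->]; last by rewrite !tnth0.
    by rewrite !tnthS tnth_subst_coord (inj_eq lift_inj).
  under [RHS]eq_integral do under eq_integral do under eq_integral do rewrite consE.
  transitivity (\int[F]_x \int[F]_v \int[iid F n]_w
      f [the n.+1.-tuple R of x :: subst_coord w j v])%E.
    by apply: eq_integral => x _; exact: (IH j _ (mcons x)).
  apply: (fubini_tonelli (m1 := F) (m2 := F) (fun xv : R * R =>
    \int[iid F n]_w f [the n.+1.-tuple R of xv.1 :: subst_coord w j xv.2])%E).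
    apply: (measurable_fun_fubini_tonelli_F (m2 := iid F n)
      (fun xvw : (R * R) * n.-tuple R =>
        f [the n.+1.-tuple R of xvw.1.1 :: subst_coord xvw.2 j xvw.1.2])) => //.
    apply: measurableT_comp => //; apply: measurable_cons.
      by apply: measurableT_comp.
    by apply: measurable_subst_coord => //; apply: measurableT_comp.
  by move=> xv; apply: integral_ge0.
- have consE v x (w : n.-tuple R) :
      subst_coord [the n.+1.-tuple R of x :: w] ord0 v =
      [the n.+1.-tuple R of v :: w].
    apply: eq_from_tnth => k; rewrite tnth_subst_coord.
    case: (unliftP ord0 k) => [l ->|->]; last by rewrite eqxx tnth0.
    by rewrite !tnthS.
  apply: eq_integral => v _.
  under [RHS]eq_integral do under eq_integral do rewrite consE.
  (* The overwritten head no longer occurs in the integrand, so its integral only contributes total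
     mass 1. *)
  by rewrite integral_cst//= probability_setT mule1.
Qed.

End resampling.

(** * Pointwise lower bounds on the surplus of lotteries *)

Section lottery_surplus.
Context (R : realType) (n : nat).
Local Notation mu := (@lebesgue_measure R).
Implicit Types (w v : n.-tuple R) (p q s m : R) (i j l : 'I_n).

(** The value terms cancel against those in [lottery_pay]; what remains is the area under each
    agent's own allocation curve. *)
Lemma residual_surplus_lottery (p q : \bar R) w :
  residual_surplus (lottery n p q) w =
  \sum_(i < n) \int[mu]_(z in `[0, tnth w i]) lottery_alloc p q i (subst_coord w i z).
Proof. by apply: eq_bigr => i _; rewrite /= /lottery_pay opprB addrC subrK. Qed.

Lemma lottery_alloc_ge0 (p q : \bar R) i v : 0 <= lottery_alloc p q i v.
Proof. by rewrite /lottery_alloc; case: ifP. Qed.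

Lemma lottery_integral_ge0 (p q : \bar R) i w :
  0 <= \int[mu]_(z in `[0, tnth w i]) lottery_alloc p q i (subst_coord w i z).
Proof. by apply: Rintegral_ge0 => z _; exact: lottery_alloc_ge0. Qed.

Lemma residual_surplus_lottery_ge0 (p q : \bar R) w :
  0 <= residual_surplus (lottery n p q) w.
Proof.
by rewrite residual_surplus_lottery sumr_ge0// => i _; exact: lottery_integral_ge0.
Qed.

Lemma lottery_alloc_eq0 p q i v : q <= p -> tnth v i <= q ->
  lottery_alloc p%:E q%:E i v = 0.
Proof.
move=> qp viq; rewrite /lottery_alloc ifF//.
by case: ifP => _; rewrite inE /above/= lte_fin ltNge ?viq ?(le_trans viq qp).
Qed.

Lemma lottery_alloc_single p q i v : p < tnth v i ->
  (forall l, l != i -> tnth v l <= p) -> lottery_alloc p%:E q%:E i v = 1.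
Proof.
move=> pi others; rewrite /lottery_alloc.
have -> : [exists l, above p%:E v l] by apply/existsP; exists i; rewrite /above/= lte_fin.
have aboveE : above p%:E v =i pred1 i.
  move=> l; rewrite !inE /above/= lte_fin; have [->|li] := eqVneq l i; first by rewrite pi.
  by rewrite ltNge others.
by rewrite aboveE inE eqxx (eq_card aboveE) card1 invr1.
Qed.

(** The disjunction covers two ways for the winners to be exactly [i] and [j], the agents above [q]:
    the two levels coincide, or nobody exceeds [p]. *)
Lemma lottery_alloc_tie p q i j v : i != j -> q < tnth v i -> q < tnth v j ->
  (forall l, l != i -> l != j -> tnth v l <= q) ->
  p = q \/ (tnth v i <= p /\ tnth v j <= p /\ q <= p) ->
  lottery_alloc p%:E q%:E i v = 2^-1.
Proof.
move=> ij qi qj others pq; rewrite /lottery_alloc.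
have aboveE : above q%:E v =i pred2 i j.
  move=> l; rewrite !inE /above/= lte_fin; have [->|li] := eqVneq l i; first by rewrite qi.
  by have [->|lj] := eqVneq l j; [rewrite qj | rewrite ltNge others].
suff -> : (if [exists l, above p%:E v l] then above p%:E v else above q%:E v) = above q%:E v.
  by rewrite aboveE !inE eqxx (eq_card aboveE) card2 ij.
case: pq => [->|[ip [jp qp]]]; first by case: ifP.
rewrite ifF//; apply/negbTE/existsPn => l; rewrite /above/= lte_fin -leNgt.
have [->//|li] := eqVneq l i; have [->//|lj] := eqVneq l j.
exact: le_trans (others _ li lj) qp.
Qed.

Lemma lottery_integral_tie m i j w : i != j -> 0 <= m -> m < tnth w j ->
  (forall l, l != i -> l != j -> tnth w l <= m) ->
  \int[mu]_(z in `[0, tnth w i]) lottery_alloc m%:E m%:E i (subst_coord w i z) =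
  2^-1 * Num.max (tnth w i - m) 0.
Proof.
move=> ij m0 mj others.
(* A second step of height 0 brings the one-jump curve into the shape of [Rintegral_steps]. *)
transitivity (\int[mu]_(z in `[0, tnth w i])
    (2^-1 * \1_`]m, +oo[%classic z + 0 * \1_`]m, +oo[%classic z)).
  apply: eq_Rintegral => z _; rewrite mul0r addr0 indicE.
  have [mz|zm] := ltP m z; last first.
    rewrite memNset ?mulr0; last by rewrite /= in_itv/= andbT ltNge zm.
    by rewrite lottery_alloc_eq0// tnth_subst_coord eqxx.
  rewrite mem_set ?mulr1; last by rewrite /= in_itv/= mz.
  apply: (@lottery_alloc_tie _ _ i j); rewrite ?tnth_subst_coord ?eqxx//.
  - by rewrite eq_sym (negbTE ij).
  - by move=> l li lj; rewrite tnth_subst_coord (negbTE li) others.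
  - by left.
by rewrite Rintegral_steps// mul0r addr0.
Qed.

(** A report of [i] wins nothing up to [m], shares the item with [j] between [m] and the value of
    [j], and wins alone above that value. *)
Lemma lottery_integral_leader m i j w : i != j -> 0 <= m -> m < tnth w j ->
  (forall l, l != i -> l != j -> tnth w l <= m) ->
  \int[mu]_(z in `[0, tnth w i])
    lottery_alloc (tnth w j)%:E m%:E i (subst_coord w i z) =
  2^-1 * Num.max (tnth w i - m) 0 + 2^-1 * Num.max (tnth w i - tnth w j) 0.
Proof.
move=> ij m0 mj others; set s := tnth w j.
have s0 : 0 <= s by rewrite (le_trans m0)// ltW.
rewrite -Rintegral_steps//.
apply: eq_Rintegral => z _; rewrite !indicE.
have [mz|zm] := ltP m z; last first.
  rewrite !memNset ?mulr0 ?addr0; last 2 first.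
  - by rewrite /= in_itv/= andbT ltNge (le_trans zm)// ltW.
  - by rewrite /= in_itv/= andbT ltNge zm.
  by rewrite lottery_alloc_eq0// ?tnth_subst_coord ?eqxx// ltW.
have -> : (z \in `]m, +oo[%classic) by rewrite mem_set//= in_itv/= mz.
have [sz|zs] := ltP s z.
  rewrite mem_set; last by rewrite /= in_itv/= sz.
  rewrite lottery_alloc_single ?tnth_subst_coord ?eqxx//; last first.
    move=> l li; rewrite tnth_subst_coord (negbTE li).
    have [->//|lj] := eqVneq l j; exact: le_trans (others _ li lj) (ltW mj).
  by rewrite !mulr1; lra.
rewrite memNset; last by rewrite /= in_itv/= andbT ltNge zs.
rewrite mulr1 mulr0 addr0.
apply: (@lottery_alloc_tie _ _ i j); rewrite ?tnth_subst_coord ?eqxx//.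
- by rewrite eq_sym (negbTE ij).
- by move=> l li lj; rewrite tnth_subst_coord (negbTE li) others.
- by right; rewrite eq_sym (negbTE ij); split => //; split => //; exact: ltW.
Qed.

Lemma top_pair_surplus_eq0 c a b : a <= c \/ b <= c -> top_pair_surplus c a b = 0 :> R.
Proof.
rewrite /top_pair_surplus; have [cb [ac|//]|//] := ltP c b.
by rewrite !max_r ?addr0// subr_le0//; lra.
Qed.

Lemma top_pair_lottery m i j w : i != j -> 0 <= m ->
  m < tnth w i -> m < tnth w j ->
  (forall l, l != i -> l != j -> tnth w l <= m) ->
  exists p q, 0 <= q <= p /\
    (top_pair_surplus m (tnth w i) (tnth w j)
     + top_pair_surplus m (tnth w j) (tnth w i)) / 2 <=
    residual_surplus (lottery n p%:E q%:E) w.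
Proof.
wlog ji : i j / tnth w j <= tnth w i.
  move=> H ij m0 mi mj others; have [ji|/ltW ji] := leP (tnth w j) (tnth w i).
    exact: (H i j).
  rewrite addrC; apply: (H j i) => //; first by rewrite eq_sym.
  by move=> l lj li; exact: others.
move=> ij m0 mi mj others.
rewrite /top_pair_surplus mi mj.
rewrite (max_l (y := 0) (x := tnth w i - m)); last by rewrite subr_ge0 ltW.
rewrite (max_l (y := 0) (x := tnth w j - m)); last by rewrite subr_ge0 ltW.
rewrite (max_r (y := 0) (x := tnth w j - _)); last by rewrite subr_le0; lra.
(* Let [a >= b] be the values of [i] and [j]. The bound [(2 * a - b - m) / 2] from [Lot_{b,m}]
   exceeds the bound [(a + b - 2 * m) / 2] from [Lot_{m,m}] by [(a - (2 * b - m)) / 2], so this sign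
   selects the lottery. All other surplus is nonnegative and dropped. *)
have [h|h] := leP (tnth w i - (2 * tnth w j - m)) 0.
  exists m, m; split; first by rewrite lexx m0.
  rewrite residual_surplus_lottery (bigD1 i)//= (bigD1 j)/=; last by rewrite eq_sym.
  have ji' : j != i by rewrite eq_sym.
  rewrite (lottery_integral_tie ij m0 mj others).
  rewrite (lottery_integral_tie ji' m0 mi (fun l lj li => others l li lj)).
  rewrite !max_l ?subr_ge0 ?(ltW mi) ?(ltW mj)//.
  set S := \sum_(_ < n | _) _.
  have : 0 <= S by rewrite sumr_ge0// => l _; exact: lottery_integral_ge0.
  by lra.
exists (tnth w j), m; split; first by rewrite m0 ltW.
rewrite residual_surplus_lottery (bigD1 i)//=.
rewrite (lottery_integral_leader ij m0 mj others).
rewrite !max_l ?subr_ge0 ?(ltW mi) ?(ltW mj)//.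
set S := \sum_(_ < n | _) _.
have : 0 <= S by rewrite sumr_ge0// => l _; exact: lottery_integral_ge0.
by lra.
Qed.

(** The base value 0 is the level used when there is no third agent, and keeps the maximum
    nonnegative on every profile. *)
Definition others_max i j w : R :=
  \big[Num.max/0]_(l < n | (l != i) && (l != j)) tnth w l.

Lemma others_maxC i j w : others_max i j w = others_max j i w.
Proof. by apply: eq_bigl => l; rewrite andbC. Qed.

Lemma others_max_ge0 i j w : 0 <= others_max i j w.
Proof. exact: bigmax_ge_id. Qed.

Lemma le_others_max i j l w : l != i -> l != j -> tnth w l <= others_max i j w.
Proof. by move=> li lj; apply: le_bigmax_cond; rewrite li lj. Qed.

(** A nonzero term forces both members of its pair strictly above everyone else, so only one
    unordered pair can contribute, and its two mirrored terms are bounded by [top_pair_lottery]. *)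
Lemma surplus_pairs_le w :
  exists p q, 0 <= q <= p /\
  (\sum_(ij : 'I_n * 'I_n | ij.1 != ij.2)
     top_pair_surplus (others_max ij.1 ij.2 w) (tnth w ij.1) (tnth w ij.2)) / 2 <=
  residual_surplus (lottery n p%:E q%:E) w.
Proof.
pose K (ij : 'I_n * 'I_n) :=
  top_pair_surplus (others_max ij.1 ij.2 w) (tnth w ij.1) (tnth w ij.2).
have [/existsP[[i j]/= /andP[ij Kij]]|] :=
  boolP [exists ij : 'I_n * 'I_n, (ij.1 != ij.2) && (K ij != 0)]; last first.
  move=> /existsPn K0; exists 0, 0; split; first by rewrite lexx.
  rewrite big1 ?mul0r ?residual_surplus_lottery_ge0// => ij ijN.
  by have := K0 ij; rewrite ijN/= negbK => /eqP.
pose m := others_max i j w.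
have mi : m < tnth w i.
  by rewrite ltNge; apply: contra Kij => h; rewrite /K top_pair_surplus_eq0//; left.
have mj : m < tnth w j.
  by rewrite ltNge; apply: contra Kij => h; rewrite /K top_pair_surplus_eq0//; right.
have [p [q [pq H]]] := top_pair_lottery ij (others_max_ge0 i j w) mi mj
  (fun l li lj => le_others_max w li lj).
exists p, q; split => //; apply: le_trans H.
rewrite (bigD1 (i, j))//= (bigD1 (j, i))/=; last first.
  by rewrite eq_sym ij/= xpair_eqE eq_sym (negbTE ij).
rewrite [in X in _ + (X + _)]others_maxC big1 ?addr0// => -[a b] /=.
rewrite !xpair_eqE -andbA => /and3P[ab abij abji].
(* If [i] or [j] is missing from the pair [a], [b], its value enters [others_max a b w] and
   dominates every agent [h] outside [i], [j]. Any other pair both misses one of [i], [j] and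
   contains such an [h], so its term vanishes. *)
have low h l : l = i \/ l = j -> l != a -> l != b -> h != i -> h != j ->
    tnth w h <= others_max a b w.
  move=> lij la lb hi hj; apply: le_trans (le_others_max w la lb).
  apply: le_trans (le_others_max w hi hj) _.
  by case: lij => ->; exact: ltW.
rewrite top_pair_surplus_eq0//.
have [ai|ai] := eqVneq a i.
  have bj : b != j by move: abij; rewrite ai eqxx.
  right; apply: (low b j); [by right| | | |by []].
  - by rewrite ai eq_sym.
  - by rewrite eq_sym.
  - by rewrite -ai eq_sym.
have [aj|aj] := eqVneq a j.
  have bi : b != i by move: abji; rewrite aj eqxx.
  right; apply: (low b i); [by left| | |by []|].
  - by rewrite aj.
  - by rewrite eq_sym.
  - by rewrite -aj eq_sym.
left; have [bi|bi] := eqVneq b i.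
  apply: (low a j); [by right| | |by []|by []].
  - by rewrite eq_sym.
  - by rewrite bi eq_sym.
apply: (low a i); [by left| | |by []|by []].
- by rewrite eq_sym.
- by rewrite eq_sym.
Qed.

End lottery_surplus.

(** * Finite sums restricted by a predicate *)

Lemma emeasurable_sum_cond d (T : measurableType d) (R : realType)
    (D : set T) (I : Type) (s : seq I) (P : pred I) (f : I -> T -> \bar R) :
  (forall i, measurable_fun D (f i)) ->
  measurable_fun D (fun x => \sum_(i <- s | P i) f i x)%E.
Proof.
by move=> mf; under eq_fun do rewrite -big_filter; exact: emeasurable_sum.
Qed.

Lemma ge0_integral_sum_cond d (T : measurableType d) (R : realType)
    (mu : {measure set T -> \bar R}) (I : Type) (s : seq I) (P : pred I)
    (f : I -> T -> \bar R) :
  (forall i, measurable_fun setT (f i)) -> (forall i x, 0 <= f i x)%E ->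
  (\int[mu]_x \sum_(i <- s | P i) f i x =
   \sum_(i <- s | P i) \int[mu]_x f i x)%E.
Proof.
move=> mf f0; rewrite -big_filter -ge0_integral_sum//.
by apply: eq_integral => x _; rewrite -big_filter.
Qed.

(** * Expected surplus of the two highest agents *)

Section top_pair_expectation.
Context (R : realType) (n : nat).
Implicit Types (w : n.-tuple R) (i j l : 'I_n).

Lemma measurable_nneg_profile : measurable (@nneg_profile R n).
Proof.
rewrite (_ : nneg_profile (n:=n) = \bigcap_(i in [set: 'I_n])
    ((@tnth n R)^~ i @^-1` `[0, +oo[%classic)); last first.
  apply/seteqP; split => w /= h i; first by move=> _; rewrite /= in_itv/= andbT.
  by have := h i Logic.I; rewrite /= in_itv/= andbT.
apply: fin_bigcap_measurable => // i _.
by rewrite -[X in measurable X]setTI; exact: measurable_tnth.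
Qed.

(** By [iid_box] the profiles with a negative coordinate form a null set. This links the interim
    integrals over [nneg_profile] with Tonelli on the whole space. *)
Lemma integral_iid_nneg (F : probability R R) (f : n.-tuple R -> \bar R) :
  F `[0, +oo[%classic = 1%E ->
  measurable_fun setT f -> (forall w, 0 <= f w)%E ->
  (\int[iid F n]_(w in @nneg_profile R n) f w = \int[iid F n]_w f w)%E.
Proof.
move=> F1 mf f0; have mN := measurable_nneg_profile.
rewrite [RHS](@ge0_negligible_integral _ _ _ _ _ (~` @nneg_profile R n))//.
- by rewrite setDE setTI setCK.
- exact: measurableC.
- rewrite [LHS]probability_setC// (_ : nneg_profile (n:=n) =
      [set w | forall i, `[0, +oo[%classic (tnth w i)]); last first.
    by apply/seteqP; split => w /= h i; have := h i; rewrite in_itv/= andbT.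
  rewrite (iid_box F (A := fun=> `[0, +oo[%classic))// big1 ?subee//.
Qed.

Lemma measurable_others_max i j :
  measurable_fun setT (fun w => others_max i j w).
Proof.
rewrite /others_max; elim: (index_enum _) => [|l s IH].
  by under eq_fun do rewrite big_nil; exact: measurable_cst.
under eq_fun do rewrite big_cons.
case: ((l != i) && (l != j)) => //; apply: measurable_maxr => //; exact: measurable_tnth.
Qed.

Lemma others_max_subst i j l w z : (l == i) || (l == j) ->
  others_max i j (subst_coord w l z) = others_max i j w.
Proof.
move=> lij; apply: eq_bigr => k /andP[ki kj]; rewrite tnth_subst_coord.
by case: (eqVneq k l) lij => // <-; rewrite (negbTE ki) (negbTE kj).
Qed.

(** Coordinates [i] and [j] are resampled in turn; [others_max i j] reads neither, so it is constant
    in the two inner integrals. *)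
Lemma integral_iid_pair (F : probability R R) i j (h : R -> R -> R -> \bar R) :
  i != j -> (forall c a b, 0 <= h c a b)%E ->
  measurable_fun setT (fun w => h (others_max i j w) (tnth w i) (tnth w j)) ->
  (\int[iid F n]_w h (others_max i j w) (tnth w i) (tnth w j) =
   \int[iid F n]_w \int[F]_b \int[F]_a h (others_max i j w) a b)%E.
Proof.
move=> ij h0 mh; set f := fun w => _ in mh.
have f0 w : (0 <= f w)%E by exact: h0.
rewrite (integral_iid_resample F i mh f0) integral_subst_swap//.
rewrite (integral_iid_resample F j); last 2 first.
- apply: (measurable_fun_fubini_tonelli_F (m2 := F)
    (fun wv : n.-tuple R * R => f (subst_coord wv.1 i wv.2))) => //.
  by apply: measurableT_comp => //; exact: measurable_subst_coord.
- by move=> w; exact: integral_ge0.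
rewrite (@integral_subst_swap _ F _ j (fun w => \int[F]_v f (subst_coord w i v))%E); last 2 first.
- apply: (measurable_fun_fubini_tonelli_F (m2 := F)
    (fun wv : n.-tuple R * R => f (subst_coord wv.1 i wv.2))) => //.
  by apply: measurableT_comp => //; exact: measurable_subst_coord.
- by move=> w; exact: integral_ge0.
apply: eq_integral => w _; apply: eq_integral => b _; apply: eq_integral => a _.
rewrite /f !others_max_subst ?eqxx ?orbT// !tnth_subst_coord !eqxx.
by rewrite eq_sym (negbTE ij).
Qed.

(** The comparisons are weak so that, with two or more agents, every nonnegative profile has a top
    pair even under ties. *)
Definition top_pair i j w : bool :=
  (others_max i j w <= tnth w i) && (others_max i j w <= tnth w j).

Lemma measurable_top_pair i j : measurable_fun setT (top_pair i j).
Proof.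
have mm := measurable_others_max i j.
by apply: measurable_and; apply: measurable_fun_ler => //; exact: measurable_tnth.
Qed.

Lemma measurable_pair_surplus i j : measurable_fun setT
  (fun w => top_pair_surplus (others_max i j w) (tnth w i) (tnth w j)).
Proof.
apply: measurable_top_pair_surplus; first exact: measurable_others_max.
- exact: measurable_tnth.
- exact: measurable_tnth.
Qed.

(** Given [c = others_max i j w], the pair earns [4 / 3 * expR (- c) ^+ 2] on average and is a top
    pair with probability [expR (- c) ^+ 2]. *)
Lemma integral_pair_surplus i j : i != j ->
  (\int[iid (exp1 R) n]_w
     (top_pair_surplus (others_max i j w) (tnth w i) (tnth w j))%:E =
   (4 / 3)%:E * \int[iid (exp1 R) n]_w ((top_pair i j w)%:R)%:E)%E.
Proof.
move=> ij; set P := iid _ _.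
have surplusE : (\int[P]_w
     (top_pair_surplus (others_max i j w) (tnth w i) (tnth w j))%:E =
   \int[P]_w ((4 / 3)%:E * (expR (- others_max i j w) ^+ 2)%:E))%E.
  etransitivity.
    apply: (@integral_iid_pair _ i j (fun c a b => (top_pair_surplus c a b)%:E) ij).
    - by move=> c a b; rewrite lee_fin top_pair_surplus_ge0.
    - by apply/measurable_EFinP; exact: measurable_pair_surplus.
  apply: eq_integral => w _; have := others_max_ge0 i j w.
  move: (others_max i j w) => c c0.
  by rewrite integral_top_pair_surplus// !exp1_tail// -!EFinM expr2 mulrA.
have topE : (\int[P]_w ((top_pair i j w)%:R)%:E =
   \int[P]_w (expR (- others_max i j w) ^+ 2)%:E)%E.
  etransitivity.
    apply: (@integral_iid_pair _ i j
      (fun c a b => (((c <= a) && (c <= b))%:R)%:E) ij).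
    - by move=> c a b; rewrite lee_fin.
    - apply/measurable_EFinP; rewrite (_ : (fun _ => _) =
        (fun w => if top_pair i j w then 1 else 0)).
        by apply: measurable_fun_ifT => //; exact: measurable_top_pair.
      by apply/funext => w; rewrite /top_pair; case: ifP.
  apply: eq_integral => w _; have := others_max_ge0 i j w.
  move: (others_max i j w) => c c0.
  have tailE : (\int[exp1 R]_x ((c <= x)%R%:R)%:E = (expR (- c))%:E)%E.
    rewrite -exp1_tail// -[X in exp1 R X]setIT -integral_indic//.
    apply: eq_integral => x _; rewrite indicE; congr ((nat_of_bool _)%:R)%:E.
    by apply/idP/idP; rewrite inE/= in_itv/= andbT.
  have mle : measurable_fun setT (fun x : R => ((c <= x)%R%:R : R)%:E).
    apply/measurable_EFinP; rewrite (_ : (fun _ => _) =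
      (fun x => if c <= x then 1 else 0)).
      by apply: measurable_fun_ifT => //; exact: measurable_fun_ler.
    by apply/funext => x; case: ifP.
  transitivity (\int[exp1 R]_b ((expR (- c))%:E * ((c <= b)%R%:R)%:E))%E.
    apply: eq_integral => b _; rewrite -tailE muleC -ge0_integralZl//.
    apply: eq_integral => a _.
    by rewrite -EFinM -natrM mulnb andbC.
  by rewrite ge0_integralZl ?lee_fin ?expR_ge0// tailE -EFinM expr2.
rewrite surplusE topE ge0_integralZl//.
apply/measurable_EFinP; apply: measurable_funX.
apply: measurableT_comp => //; apply: measurableT_comp => //.
exact: measurable_others_max.
Qed.

Lemma top_pairs_ge2 w : (2 <= n)%N -> nneg_profile w ->
  2 <= \sum_(ij : 'I_n * 'I_n | ij.1 != ij.2) (top_pair ij.1 ij.2 w)%:R :> R.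
Proof.
move=> n2 w0; pose i0 := Ordinal (ltnW n2).
pose i := [arg max_(i > i0) tnth w i]%O.
have wi l : tnth w l <= tnth w i by rewrite /i; case: arg_maxP => // a _; exact.
have /card_gt0P[j0 j0i] : (0 < #|predC1 i|)%N.
  by rewrite cardC1 card_ord -subn1 subn_gt0.
pose j := [arg max_(j > j0 | j != i) tnth w j]%O.
have [ji wj] : j != i /\ forall l, l != i -> tnth w l <= tnth w j.
  by rewrite /j; case: arg_maxP => // a ai H; split.
have mj : others_max i j w <= tnth w j.
  (* Nonnegativity of the profile handles the base value 0 of the maximum. *)
  by apply/bigmax_leP; split; [exact: w0 | move=> l /andP[li _]; exact: wj].
have mi := le_trans mj (wi j).
rewrite (bigD1 (i, j))/=; last by rewrite eq_sym.
rewrite (bigD1 (j, i))/=; last by rewrite ji xpair_eqE (negbTE ji).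
rewrite /top_pair (others_maxC j i) mi mj/= addrA lerDl.
by rewrite sumr_ge0.
Qed.

Lemma integral_surplus_pairs_ge : (2 <= n)%N ->
  ((4 / 3)%:E <= \int[iid (exp1 R) n]_w
    ((\sum_(ij : 'I_n * 'I_n | ij.1 != ij.2)
     top_pair_surplus (others_max ij.1 ij.2 w) (tnth w ij.1) (tnth w ij.2)) / 2)%:E)%E.
Proof.
move=> n2; set P := iid _ _.
pose K (ij : 'I_n * 'I_n) w : R :=
  top_pair_surplus (others_max ij.1 ij.2 w) (tnth w ij.1) (tnth w ij.2).
pose t (ij : 'I_n * 'I_n) w : R := (top_pair ij.1 ij.2 w)%:R.
have mK ij : measurable_fun setT (EFin \o K ij).
  by apply/measurable_EFinP; exact: measurable_pair_surplus.
have mt ij : measurable_fun setT (EFin \o t ij).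
  apply/measurable_EFinP; rewrite (_ : t ij =
    (fun w => if top_pair ij.1 ij.2 w then 1 else 0)).
    by apply: measurable_fun_ifT => //; exact: measurable_top_pair.
  by apply/funext => w; rewrite /t; case: ifP.
have K0 ij w : (0 <= (K ij w)%:E)%E by rewrite lee_fin top_pair_surplus_ge0.
have t0 ij w : (0 <= (t ij w)%:E)%E by rewrite lee_fin.
(* The factor 2/3 is half of the 4/3 that [integral_pair_surplus] gives for each ordered pair. *)
have -> : (\int[P]_w ((\sum_(ij | ij.1 != ij.2) K ij w) / 2)%:E =
    (2 / 3)%:E * \int[P]_w (\sum_(ij | ij.1 != ij.2) t ij w)%:E)%E.
  under eq_integral do rewrite mulrC EFinM -sumEFin.
  rewrite ge0_integralZl//; last 2 first.
  - exact: emeasurable_sum_cond.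
  - by move=> w _; exact: sume_ge0.
  under [in RHS]eq_integral do rewrite -sumEFin.
  rewrite !ge0_integral_sum_cond//.
  under eq_bigr => ij ijN do rewrite integral_pair_surplus//.
  rewrite -ge0_sume_distrr//; last first.
    by move=> ij _; exact: integral_ge0.
  by rewrite muleA -EFinM; congr (_ * _)%E; congr EFin; field.
(* The 2 counts the two orders of a top pair; integrating it over nonnegative profiles, of mass 1,
   prepares the comparison by [top_pairs_ge2]. *)
have -> : ((4 / 3)%:E = (2 / 3)%:E * \int[P]_(w in @nneg_profile R n) (cst 2%:E w) :> \bar R)%E.
  rewrite (integral_iid_nneg (F := exp1 R))//; last 2 first.
  - by rewrite exp1_tail// oppr0 expR0.
  - by move=> w; rewrite lee_fin.
  rewrite integral_cst//= probability_setT mule1 -EFinM; congr EFin.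
  by field.
rewrite lee_pmul2l// -integral_iid_nneg; last 3 first.
- by rewrite exp1_tail// oppr0 expR0.
- by under eq_fun do rewrite -sumEFin; exact: emeasurable_sum_cond.
- by move=> w; rewrite -sumEFin; exact: sume_ge0.
apply: ge0_le_integral => //.
- exact: measurable_nneg_profile.
- by move=> w _; rewrite lee_fin.
- apply: measurable_funTS; under eq_fun do rewrite -sumEFin.
  exact: emeasurable_sum_cond.
- by move=> w wN; rewrite lee_fin top_pairs_ge2.
Qed.

End top_pair_expectation.

(** * Upper bound on the surplus of a platform mechanism *)

Section platform_surplus.
Context (R : realType) (n : nat) (M : mechanism R n).
Hypothesis hM : platform_mechanism M.
Local Notation F := (exp1 R).
Local Notation P := (iid (exp1 R) n).
Local Notation nneg := (@nneg_profile R n).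
Implicit Types (w : n.-tuple R) (i : 'I_n).

(** The mechanism is constrained only on nonnegative profiles; extension by 0 makes allocations and
    payments measurable and nonnegative everywhere. *)
Let A i w : R := (alloc M i \_ nneg) w.
Let B i w : R := (pay M i \_ nneg) w.

Let mA i : measurable_fun setT (A i).
Proof.
apply/(measurable_restrictT _ _).1; first exact: measurable_nneg_profile.
exact: alloc_measurable.
Qed.

Let mB i : measurable_fun setT (B i).
Proof.
apply/(measurable_restrictT _ _).1; first exact: measurable_nneg_profile.
exact: pay_measurable.
Qed.

Let A01 i w : 0 <= A i w <= 1.
Proof.
rewrite /A patchE; case: ifPn => [|_]; last by rewrite lexx ler01.
by rewrite inE; exact: alloc_itv.
Qed.

Let B0 i w : 0 <= B i w.
Proof.
by rewrite /B patchE; case: ifPn => //; rewrite inE; exact: pay_ge0.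
Qed.

Let nneg_subst i w z : 0 <= z -> nneg w -> nneg (subst_coord w i z).
Proof. by move=> z0 w0 j; rewrite tnth_subst_coord; case: ifP. Qed.

Let mEA i : measurable_fun setT (EFin \o A i).
Proof. exact/measurable_EFinP. Qed.

Let mEB i : measurable_fun setT (EFin \o B i).
Proof. exact/measurable_EFinP. Qed.

Let EA0 i w : (0 <= (A i w)%:E)%E.
Proof. by rewrite lee_fin; case/andP: (A01 i w). Qed.

Let EB0 i w : (0 <= (B i w)%:E)%E.
Proof. by rewrite lee_fin. Qed.

Let msubst i v (f : n.-tuple R -> \bar R) : measurable_fun setT f ->
  measurable_fun setT (fun w => f (subst_coord w i v)).
Proof.
by move=> mf; apply: measurableT_comp => //; exact: measurable_subst_coord.
Qed.

Let exp1_nneg : F `[0, +oo[%classic = 1%E.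
Proof. by rewrite exp1_tail// oppr0 expR0. Qed.

Let X i v := (\int[P]_w (A i (subst_coord w i v))%:E)%E.
Let Y i v := (\int[P]_w (B i (subst_coord w i v))%:E)%E.

Let interim_allocE i v : 0 <= v -> interim_alloc M F i v = X i v.
Proof.
move=> v0; rewrite /X -integral_iid_nneg//; last exact: (msubst i v (mEA i)).
apply: eq_integral => w; rewrite inE => w0.
by rewrite /A patchE mem_set//; exact: nneg_subst.
Qed.

Let interim_payE i v : 0 <= v -> interim_pay M F i v = Y i v.
Proof.
move=> v0; rewrite /Y -integral_iid_nneg//; last exact: (msubst i v (mEB i)).
apply: eq_integral => w; rewrite inE => w0.
by rewrite /B patchE mem_set//; exact: nneg_subst.
Qed.

Let subst_lt0 i w v : v < 0 -> subst_coord w i v \notin nneg.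
Proof.
move=> v0; rewrite notin_setE => /(_ i).
by rewrite tnth_subst_coord eqxx leNgt v0.
Qed.

Let X_lt0 i v : v < 0 -> X i v = 0%E.
Proof.
move=> v0; apply: integral0_eq => w _.
by rewrite /A patchE (negbTE (subst_lt0 _ _ v0)).
Qed.

Let Y_lt0 i v : v < 0 -> Y i v = 0%E.
Proof.
move=> v0; apply: integral0_eq => w _.
by rewrite /B patchE (negbTE (subst_lt0 _ _ v0)).
Qed.

Let X0 i v : (0 <= X i v)%E.
Proof. exact: integral_ge0. Qed.

Let Y0 i v : (0 <= Y i v)%E.
Proof. exact: integral_ge0. Qed.

Let X1 i v : (X i v <= 1)%E.
Proof.
apply: (@le_trans _ _ (\int[P]_w cst 1%E w)%E); last first.
  by rewrite integral_cst//= probability_setT mule1.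
apply: ge0_le_integral => //; first exact: (msubst i v (mEA i)).
by move=> w _; rewrite lee_fin; case/andP: (A01 i (subst_coord w i v)).
Qed.

Let X_fin i v : X i v \is a fin_num.
Proof. by rewrite ge0_fin_numE// (le_lt_trans (X1 i v))// ltry. Qed.

(** Individual rationality caps the interim payment by [v] times an allocation of at most 1. The
    bound makes payments finite, and its shape is that of [integral_exp1_excess] at 0. *)
Let Y_le i v : (Y i v <= (Num.max (v - 0) 0)%:E)%E.
Proof.
have [v0|v0] := leP 0 v; last by rewrite Y_lt0// lee_fin le_max lexx orbT.
have := platform_IR hM (exp1_continuous_distribution R) i v0.
rewrite /interim_utility interim_allocE// interim_payE// subr0 max_l//.
rewrite sube_ge0; last by rewrite fin_numM ?X_fin ?orbT//.
move=> /le_trans; apply.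
by rewrite -[leRHS]mule1 lee_wpmul2l ?lee_fin// X1.
Qed.

Let Y_fin i v : Y i v \is a fin_num.
Proof. by rewrite ge0_fin_numE// (le_lt_trans (Y_le i v))// ltry. Qed.

Let mX i : measurable_fun setT (X i).
Proof. exact: (measurable_integral_subst F i (mEA i) (EA0 i)). Qed.

Let mY i : measurable_fun setT (Y i).
Proof. exact: (measurable_integral_subst F i (mEB i) (EB0 i)). Qed.

Let mvalue i : measurable_fun setT (fun w => (tnth w i * A i w)%:E).
Proof.
apply/measurable_EFinP; apply: measurable_funM => //.
exact: measurable_tnth.
Qed.

Let value0 i w : (0 <= (tnth w i * A i w)%:E)%E.
Proof.
rewrite lee_fin /A patchE; case: ifPn => [|_]; last by rewrite mulr0.
rewrite inE => w0; rewrite mulr_ge0//.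
by case/andP: (alloc_itv hM i w0).
Qed.

(** Resampling coordinate [i] reduces the claim to [exp1_envelope] for the interim allocation and
    payment, which are finite and truthful. *)
Lemma platform_value_le i :
  (\int[P]_w (tnth w i * A i w)%:E <=
   \int[P]_w (B i w)%:E + \int[P]_w (A i w)%:E)%E.
Proof.
rewrite (integral_iid_resample F i (mEA i) (EA0 i)).
rewrite (integral_iid_resample F i (mEB i) (EB0 i)).
rewrite (integral_iid_resample F i (mvalue i) (value0 i)).
have valueE v : (\int[P]_w (tnth (subst_coord w i v) i * A i (subst_coord w i v))%:E
    = (v * fine (X i v))%:E)%E.
  under eq_integral do rewrite tnth_subst_coord eqxx EFinM.
  have [v0|v0] := leP 0 v.
    by rewrite ge0_integralZl ?lee_fin// ?EFinM ?fineK//; exact: (msubst i v (mEA i)).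
  rewrite X_lt0// mulr0 integral0_eq// => w _.
  by rewrite /A patchE (negbTE (subst_lt0 _ _ v0)) mule0.
under eq_integral do rewrite valueE.
have -> : (\int[F]_v \int[P]_w (A i (subst_coord w i v))%:E =
    \int[F]_v (fine (X i v))%:E)%E.
  by apply: eq_integral => v _; rewrite fineK.
have -> : (\int[F]_v \int[P]_w (B i (subst_coord w i v))%:E =
    \int[F]_v (fine (Y i v))%:E)%E.
  by apply: eq_integral => v _; rewrite fineK.
apply: exp1_envelope.
- exact: measurableT_comp.
- exact: measurableT_comp.
- by move=> v; exact: fine_ge0.
- by move=> v; exact: fine_ge0.
- by move=> v v0; rewrite X_lt0.
- move=> v b v0 b0.
  have := platform_BNE hM (exp1_continuous_distribution R) i v0 b0.
  rewrite /interim_utility !interim_allocE// !interim_payE//.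
  by rewrite -(fineK (X_fin i v)) -(fineK (X_fin i b)) -(fineK (Y_fin i v))
    -(fineK (Y_fin i b)) -!EFinM -!EFinB lee_fin.
Qed.

Let payment_le1 i : (\int[P]_w (B i w)%:E <= 1)%E.
Proof.
rewrite (integral_iid_resample F i (mEB i) (EB0 i)).
rewrite -[leRHS](_ : \int[F]_v (Num.max (v - 0) 0)%:E = 1)%E; last first.
  by rewrite integral_exp1_excess// oppr0 expR0.
apply: ge0_le_integral => //.
- by move=> v _; exact: Y0.
- exact: mY.
- apply/measurable_EFinP; apply: measurable_maxr => //.
  exact: measurable_funB.
- by move=> v _; exact: Y_le.
Qed.

Let alloc_le1 : (\sum_(i < n) \int[P]_w (A i w)%:E <= 1)%E.
Proof.
rewrite -ge0_integral_sum//.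
apply: (@le_trans _ _ (\int[P]_w cst 1%E w)%E); last first.
  by rewrite integral_cst//= probability_setT mule1.
apply: ge0_le_integral => //.
- by move=> w _; exact: sume_ge0.
- exact: emeasurable_sum.
move=> w _; rewrite sumEFin lee_fin.
have [w0|w0] := boolP (w \in nneg); last first.
  by rewrite big1// => i _; rewrite /A patchE (negbTE w0).
under eq_bigr do rewrite /A patchE w0.
by apply: alloc_sum => //; rewrite inE in w0.
Qed.

(** With payments moved to the left, every integrand is nonnegative. Expected value exceeds expected
    payments by at most the expected total allocation, hence by at most 1, and the finite expected
    payments cancel. *)
Lemma platform_ratio_ge (beta : R) (K : n.-tuple R -> R) : 0 < beta ->
  measurable_fun setT K -> (forall w, 0 <= K w) ->
  (forall w, nneg w -> K w <= beta * residual_surplus M w) ->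
  (\int[P]_w (K w)%:E <= beta%:E)%E.
Proof.
move=> beta0 mK K0 Kle.
have mEK : measurable_fun setT (EFin \o K) by exact/measurable_EFinP.
have EK0 w : (0 <= (K w)%:E)%E by rewrite lee_fin.
pose SB w := (\sum_(i < n) (B i w)%:E)%E.
pose SV w := (\sum_(i < n) (tnth w i * A i w)%:E)%E.
have mSB : measurable_fun setT SB by exact: emeasurable_sum.
have mSV : measurable_fun setT SV by exact: emeasurable_sum.
have SB0 w : (0 <= SB w)%E by exact: sume_ge0.
have SV0 w : (0 <= SV w)%E by exact: sume_ge0.
have beta0E : (0 <= beta%:E)%E by rewrite lee_fin ltW.
have main : (\int[P]_w (K w)%:E + beta%:E * \int[P]_w SB w <=
    beta%:E * \int[P]_w SV w)%E.
  rewrite -!ge0_integralZl// -ge0_integralD//; last 2 first.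
  - by move=> w _; exact: mule_ge0.
  - exact: emeasurable_funM.
  rewrite -(integral_iid_nneg exp1_nneg); last 2 first.
  - by apply: emeasurable_funD => //; exact: emeasurable_funM.
  - by move=> w; rewrite adde_ge0// mule_ge0.
  rewrite -(integral_iid_nneg exp1_nneg); last 2 first.
  - exact: emeasurable_funM.
  - by move=> w; exact: mule_ge0.
  apply: ge0_le_integral => //.
  - exact: measurable_nneg_profile.
  - by move=> w _; rewrite adde_ge0// mule_ge0.
  - apply: measurable_funTS; apply: emeasurable_funD => //.
    exact: emeasurable_funM.
  - by apply: measurable_funTS; exact: emeasurable_funM.
  move=> w w0; rewrite /SB /SV !sumEFin -!EFinM -EFinD lee_fin -lerBrDr -mulrBr.
  rewrite -sumrB; apply: le_trans (Kle w w0) _; rewrite ler_pM2l//.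
  by rewrite /residual_surplus ler_sum// => i _; rewrite /A /B !patchE mem_set.
have SB_fin : (\int[P]_w SB w \is a fin_num)%E.
  rewrite ge0_integral_sum//; apply/sum_fin_numP => i _ _.
  by rewrite ge0_fin_numE ?integral_ge0// (le_lt_trans (payment_le1 i))// ltry.
have SV_le : (\int[P]_w SV w <= \int[P]_w SB w + 1)%E.
  rewrite !ge0_integral_sum//; apply: le_trans.
    by apply: lee_sum => i _; exact: platform_value_le.
  by rewrite big_split/= leeD2l.
have := le_trans main (lee_wpmul2l beta0E SV_le).
rewrite -(fineK SB_fin) -EFinD -!EFinM mulrDr mulr1 [X in (_ <= X)%E]EFinD addeC.
by rewrite leeD2lE.
Qed.

End platform_surplus.

(** * The lower bound 4/3 on the competitive advantage *)

Theorem corollary5p5 (R : realType) (n : nat) (hn : (2 <= n)%N)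
    (beta : R) (hbeta0 : 0 < beta) (hbeta : beta < 4 / 3)
    (M : mechanism R n) (hM : platform_mechanism M) :
  exists v : n.-tuple R, nneg_profile v /\
    ((residual_surplus M v)%:E < (beta^-1)%:E * benchmark v)%E.
Proof.
apply: contrapT => noprofile.
(* [K] is a measurable pointwise lower bound on the benchmark with mean at least 4/3. *)
pose K (w : n.-tuple R) := (\sum_(ij : 'I_n * 'I_n | ij.1 != ij.2)
  top_pair_surplus (others_max ij.1 ij.2 w) (tnth w ij.1) (tnth w ij.2)) / 2.
suff : ((4 / 3)%:E <= beta%:E)%E by rewrite lee_fin leNgt hbeta.
apply: le_trans (integral_surplus_pairs_ge R hn) _.
apply: (platform_ratio_ge hM (K := K)) => //.
- apply: measurable_funM => //; under eq_fun do rewrite -big_filter.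
  by apply: measurable_sum => ij; exact: measurable_pair_surplus.
- by move=> w; rewrite divr_ge0// sumr_ge0// => ij _; exact: top_pair_surplus_ge0.
move=> w w0; have [p [q [pq Kle]]] := surplus_pairs_le w.
apply: le_trans Kle _; rewrite -ler_pdivrMl// -lee_fin EFinM.
apply: (@le_trans _ _ ((beta^-1)%:E * benchmark w)%E).
  rewrite lee_pmul2l ?lte_fin ?invr_gt0//.
  by apply: ereal_sup_ubound; exists (p%:E, q%:E) => //=; rewrite !lee_fin.
by rewrite leNgt; apply/negP => lt; apply: noprofile; exists w.
Qed.
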